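(* Let $(\Omega,\mathcal{F},P)$ be a probability space and $d$ a positive integer. Let $\bar{B}_{1}(\mathbb{R}^{d})=\{y\in\mathbb{R}^{d}:|y|\leq1\}$ and $\partial\bar{B}_{1}(\mathbb{R}^{d})=\{y\in\mathbb{R}^{d}:|y|=1\}$, where $|\cdot|$ denotes the Euclidean norm on $\mathbb{R}^{d}$. Then $L^{0}(\mathcal{F},\partial\bar{B}_{1}(\mathbb{R}^{d}))$ is not a $\mathcal{T}_{c}$-$r$-image of $L^{0}(\mathcal{F},\bar{B}_{1}(\mathbb{R}^{d}))$. In particular, $L^{0}(\mathcal{F},\partial\bar{B}_{1}(\mathbb{R}^{d}))$ is not a $\mathcal{T}_{c}$-retract of $L^{0}(\mathcal{F},\bar{B}_{1}(\mathbb{R}^{d}))$.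
   Context: For a separable metric space $M$, $L^0(\mathcal{F},M)$ is the set of a.s.-equivalence classes of $M$-valued $\mathcal{F}$-measurable functions on $\Omega$; $L^0(\mathcal{F},\mathbb{R}^d)$ is a module over $L^0(\mathcal{F})=L^0(\mathcal{F},\mathbb{R})$, with $L^0$-norm $\|x\|=\sqrt{\sum_{i=1}^dx_i^2}$. $L^0_{++}(\mathcal{F})=\{\xi\in L^0(\mathcal{F}):\xi>0\text{ a.s.}\}$. $\mathcal{T}_c$ is the topology on $L^0(\mathcal{F},\mathbb{R}^d)$ with base the random open balls $B(x,r)=\{y:\|x-y\|<r\text{ a.s.}\}$, $r\in L^0_{++}(\mathcal{F})$. Note $L^0(\mathcal{F},\bar B_1(\mathbb{R}^d))=\{x\in L^0(\mathcal{F},\mathbb{R}^d):\|x\|\le1\}$. A subset $G$ of $L^0(\mathcal{F},\mathbb{R}^d)$ is $\sigma$-stable if $\sum_n\tilde I_{A_n}x_n\in G$ for every sequence $\{x_n\}$ in $G$ and every countable measurable partition $\{A_n\}$ of $\Omega$ ($\tilde I_A$ is the class of the indicator of $A$). A mapping $f$ between $\sigma$-stable sets is $\sigma$-stable if $f(\sum_n\tilde I_{A_n}x_n)=\sum_n\tilde I_{A_n}f(x_n)$ for all such data; it is $\mathcal{T}_c$-continuous if continuous for $\mathcal{T}_c$ on domain and range. For $\sigma$-stable subsets $E,F$ of $L^0(\mathcal{F},\mathbb{R}^d)$, $E$ is a $\mathcal{T}_c$-$r$-image of $F$ if there exist $\mathcal{T}_c$-continuous $\sigma$-stable mappings $h:F\to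 E$ and $g:E\to F$ such that $h\circ g$ is the identity on $E$. If moreover $E\subseteq F$ and $g$ is the inclusion mapping, $E$ is called a $\mathcal{T}_c$-retract of $F$ (and $h$ a $\mathcal{T}_c$-retraction). *)

(* Defs.v *)
From HB Require Import structures.
From mathcomp Require Import all_boot all_order all_algebra.
From mathcomp Require Import all_classical all_reals all_analysis.
From mathcomp Require Import measurable_realfun ring lra.

Set Implicit Arguments.
Unset Strict Implicit.
Unset Printing Implicit Defensive.

Import Order.TTheory GRing.Theory Num.Theory.
Import numFieldNormedType.Exports.

Local Open Scope classical_set_scope.
Local Open Scope ring_scope.

Section euclidean_norm.
Context {R : realType} {d : nat}.
Implicit Types u v : 'rV[R]_d.

(* The library norm `|v| on 'rV[R]_d is the sup norm. *)
Definition enorm v : R := Num.sqrt (\sum_(i < d) v ord0 i ^+ 2).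

Definition closed_unit_ball : set 'rV[R]_d := [set v | enorm v <= 1].

Definition unit_sphere : set 'rV[R]_d := [set v | enorm v = 1].

Lemma enorm0 : enorm 0 = 0.
Proof.
by rewrite /enorm big1 ?sqrtr0// => i _; rewrite mxE expr0n.
Qed.

Lemma enormN v : enorm (- v) = enorm v.
Proof. by rewrite /enorm; under eq_bigr do rewrite mxE sqrrN. Qed.

Let sumsq v : R := \sum_(i < d) v ord0 i ^+ 2.

Let sumsq_ge0 v : 0 <= sumsq v.
Proof. by apply: sumr_ge0 => i _; rewrite sqr_ge0. Qed.

Let enorm_ge0 v : 0 <= enorm v. Proof. exact: sqrtr_ge0. Qed.

Let enorm_sqr v : enorm v ^+ 2 = sumsq v.
Proof. by rewrite sqr_sqrtr ?sumsq_ge0. Qed.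

Let dot u v : R := \sum_(i < d) u ord0 i * v ord0 i.

Let cauchy_schwarz u v : dot u v ^+ 2 <= sumsq u * sumsq v.
Proof.
have E (t : R) : 0 <= sumsq u * t ^+ 2 + dot u v * t *+ 2 + sumsq v.
  have -> : sumsq u * t ^+ 2 + dot u v * t *+ 2 + sumsq v =
      \sum_(i < d) (u ord0 i * t + v ord0 i) ^+ 2.
    rewrite /sumsq /dot !mulr_suml -sumrMnl -!big_split/=.
    by apply: eq_bigr => i _; ring.
  by apply: sumr_ge0 => i _; rewrite sqr_ge0.
have [u0|u_neq0] := eqVneq (sumsq u) 0.
  have u0i i : u ord0 i = 0.
    have /psumr_eq0P/(_ i isT)/eqP := u0.
    by rewrite sqrf_eq0 => H; apply/eqP/H => // j _; rewrite sqr_ge0.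
  rewrite u0 mul0r /dot big1 ?expr0n// => i _.
  by rewrite u0i mul0r.
have u_gt0 : 0 < sumsq u by rewrite lt_def u_neq0 sumsq_ge0.
have := E (- dot u v / sumsq u).
have -> : sumsq u * (- dot u v / sumsq u) ^+ 2
    + dot u v * (- dot u v / sumsq u) *+ 2 + sumsq v =
    (sumsq u * sumsq v - dot u v ^+ 2) / sumsq u by field.
by rewrite pmulr_lge0 ?invr_gt0// subr_ge0.
Qed.

Lemma enormD u v : enorm (u + v) <= enorm u + enorm v.
Proof.
rewrite -(@ler_pXn2r _ 2)// ?nnegrE ?addr_ge0 ?enorm_ge0//.
rewrite sqrrD !enorm_sqr.
have -> : sumsq (u + v) = sumsq u + dot u v *+ 2 + sumsq v.
  rewrite /sumsq /dot -sumrMnl -!big_split/=.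
  by apply: eq_bigr => i _; rewrite mxE; ring.
rewrite lerD2r lerD2l lerMn2r/=.
rewrite (le_trans (ler_norm _))// -(@ler_pXn2r _ 2)//.
  by rewrite exprMn !enorm_sqr real_normK ?num_real// cauchy_schwarz.
by rewrite nnegrE mulr_ge0.
Qed.

End euclidean_norm.

(* 'rV[R]_d with its Borel sigma-algebra *)
Notation borelrV R d := (g_sigma_algebraType (@open 'rV[R]_d)).

(* L^0(F, R): a.s.-classes of measurable functions.  A class coerces to a
   chosen representative, which is only ever used up to a.s. equality. *)
Definition L0 d0 (T : measurableType d0) (R : realType)
    (P : probability T R) : Type := {mfun_ P, T >-> measurableTypeR R}.

Definition L0_fun d0 (T : measurableType d0) (R : realType)
    (P : probability T R) (r : L0 P) : T -> R := aqEqMfun_to_fun r.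
Coercion L0_fun : L0 >-> Funclass.

(* L^0(F, R^d) *)
Definition L0rV d0 (T : measurableType d0) (R : realType)
    (P : probability T R) (d : nat) : Type := {mfun_ P, T >-> borelrV R d}.

Definition L0rV_fun d0 (T : measurableType d0) (R : realType)
    (P : probability T R) (d : nat) (x : L0rV P d) : T -> 'rV[R]_d :=
  aqEqMfun_to_fun x.
Coercion L0rV_fun : L0rV >-> Funclass.

Section L0rV.
Context d0 (T : measurableType d0) (R : realType) (P : probability T R).
Context (d : nat).
Local Notation E := (L0rV P d).

Definition L0pp : set (L0 P) := [set r : L0 P | \forall w \ae P, 0 < r w].

Definition rball (x : E) (r : L0 P) : set E :=
  [set y : E | \forall w \ae P, enorm (x w - y w) < r w].

Lemma measurable_coord (i : 'I_d) :
  measurable_fun setT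
    (fun v : borelrV R d => (v : 'rV[R]_d) ord0 i : measurableTypeR R).
Proof.
apply: (measurability _ (RGenOpens.measurableE R)).
move=> _ [_ [a [b ->]] <-]; rewrite setTI; apply: sub_sigma_algebra.
have /continuousP := @coord_continuous R 1 d ord0 i.
by apply; exact: interval_open.
Qed.

Lemma measurable_enormB (x y : {mfun T >-> borelrV R d}) :
  measurable_fun setT
    (fun w => enorm ((x w : 'rV[R]_d) - (y w : 'rV[R]_d)) : measurableTypeR R).
Proof.
apply: (@measurableT_comp _ _ _ _ _ _ (@Num.sqrt R)).
  apply: continuous_measurable_fun; exact: sqrt_continuous.
apply: measurable_sum => i; apply: measurable_funX.
have mz (z : {mfun T >-> borelrV R d}) :
    measurable_fun setT (fun w => (z w : 'rV[R]_d) ord0 i : measurableTypeR R).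
  exact: (measurableT_comp (measurable_coord i) (measurable_funPT z)).
under eq_fun do rewrite !mxE.
exact: (measurable_funB (mz x) (mz y)).
Qed.

Definition ae_class d1 (U : measurableType d1) (f : {mfun T >-> U}) :
    {mfun_ P, T >-> U} := (\pi_({mfun_ P, T >-> U}) f)%qT.

Lemma ae_classP d1 (U : measurableType d1) (f g : {mfun T >-> U}) :
  ae_class f = ae_class g <-> f = g %[ae P].
Proof. by split=> [/eqmodP/asboolP|fg]; last exact/eqmodP/asboolP. Qed.

Lemma ae_classE d1 (U : measurableType d1) (f : {mfun T >-> U}) :
  aqEqMfun_to_fun (ae_class f) = f %[ae P].
Proof. by apply/ae_classP; rewrite /ae_class reprK. Qed.

Lemma L0_of_fun (f : T -> measurableTypeR R) :
  measurable_fun setT f -> exists r : L0 P, (r : T -> R) = f %[ae P].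
Proof.
move=> mf; have fin : f \in mfun by rewrite inE.
by exists (ae_class (mfun_Sub fin)); exact: (ae_classE (mfun_Sub fin)).
Qed.

HB.instance Definition _ := Choice.on E.

Definition rballs : set (set E) :=
  [set B | exists x r, L0pp r /\ B = rball x r].

Lemma rballs_cover : \bigcup_(B in rballs) B = setT.
Proof.
apply/seteqP; split=> // x _.
have [r r1] := L0_of_fun (measurable_cst (1 : measurableTypeR R)).
exists (rball x r).
  exists x, r; split=> //.
  by apply: filterS r1 => w -> //; exact: ltr01.
by apply: filterS r1 => w -> //; rewrite subrr enorm0 ltr01.
Qed.

Lemma rballs_join (A B : set E) (t : E) :
  rballs A -> rballs B -> A t -> B t ->
  exists C, [/\ rballs C, C t & C `<=` A `&` B].
Proof.
move=> [x [r [r0 ->]]] [y [s [s0 ->]]] xt yt.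
have mf : measurable_fun setT (fun w =>
    Num.min (r w - enorm (x w - t w)) (s w - enorm (y w - t w))
    : measurableTypeR R).
  apply: measurable_minr; apply: measurable_funB.
  - exact: (@measurable_funPT _ _ _ _ (repr r)).
  - exact: measurable_enormB.
  - exact: (@measurable_funPT _ _ _ _ (repr s)).
  - exact: measurable_enormB.
have [q qE] := L0_of_fun mf.
have q0 : L0pp q.
  move: xt yt qE; apply: filterS3 => w xt yt qE.
  by rewrite qE// lt_min !subr_gt0 xt yt.
exists (rball t q); split; first by exists t, q.
  by apply: filterS q0 => w; rewrite subrr enorm0.
move=> z tz; split.
  move: tz qE; apply: filterS2 => w /[swap] -> //.
  rewrite lt_min => /andP[+ _].
  rewrite ltrBrDl; apply: le_lt_trans.
  by rewrite -[X in enorm X](subrKA (t w)) enormD.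
move: tz qE; apply: filterS2 => w /[swap] -> //.
rewrite lt_min => /andP[_ +].
rewrite ltrBrDl; apply: le_lt_trans.
by rewrite -[X in enorm X](subrKA (t w)) enormD.
Qed.

(* The topology T_c *)
HB.instance Definition _ := isBaseTopological.Build E rballs_cover rballs_join.

Lemma open_rballsP (A : set E) :
  open A <-> exists2 B : set (set E), B `<=` rballs & \bigcup_(C in B) C = A.
Proof. by []. Qed.

Record mpartition := MPartition {
  mpart :> nat -> set T;
  mpart_measurable : forall n, measurable (mpart n);
  mpart_trivIset : trivIset setT mpart;
  mpart_cover : \bigcup_n mpart n = setT }.

Definition glue_fun (A : mpartition) (x : nat -> T -> 'rV[R]_d) (w : T) :
    'rV[R]_d :=
  limn (series (fun n => (\1_(A n) w : R) *: x n w)).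

Lemma glue_funE (A : mpartition) (x : nat -> T -> 'rV[R]_d) n w :
  A n w -> glue_fun A x w = x n w.
Proof.
move=> Anw; apply: cvg_lim => //.
apply: (@cvg_near_cst _ _ _ _ _ _); exists n.+1 => // k /= nk.
rewrite /series/= (bigD1_seq n)/= ?iota_uniq ?mem_index_iota//.
rewrite indicE mem_set// scale1r big1 ?addr0// => i /negP in_.
rewrite indicE memNset ?scale0r// => Aiw; apply: in_; apply/eqP.
exact: (@mpart_trivIset A i n I I (ex_intro _ w (conj Aiw Anw))).
Qed.

Lemma measurable_glue_fun (A : mpartition)
    (x : nat -> {mfun T >-> borelrV R d}) :
  measurable_fun setT (glue_fun A x : T -> borelrV R d).
Proof.
move=> _ Y mY; rewrite setTI.
have -> : glue_fun A x @^-1` Y = \bigcup_n (A n `&` (x n @^-1` Y)).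
  apply/seteqP; split=> [w Yw|w [n _ [Anw Yw]]].
    have [n _ Anw] : (\bigcup_n A n) w by rewrite mpart_cover.
    by exists n => //; split=> //; rewrite /= -(glue_funE x Anw).
  by rewrite /= (glue_funE x Anw).
apply: bigcup_measurable => n _; apply: measurableI.
  exact: mpart_measurable.
exact: measurable_funPTI.
Qed.

Definition glue_mfun (A : mpartition) (x : nat -> {mfun T >-> borelrV R d}) :
    {mfun T >-> borelrV R d} := mfun_Sub (mem_set (measurable_glue_fun A x)).

(* glue A x = \sum_n I_(A n) x n *)
Definition glue (A : mpartition) (x : nat -> E) : E :=
  ae_class (glue_mfun A (fun n => repr (x n))).

Definition sigma_stable (G : set E) : Prop :=
  forall (A : mpartition) (x : nat -> E), (forall n, G (x n)) -> G (glue A x).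

Definition sigma_stable_map (G : set E) (f : E -> E) : Prop :=
  forall (A : mpartition) (x : nat -> E), (forall n, G (x n)) ->
    f (glue A x) = glue A (f \o x).

(* L^0(F, M), seen inside L^0(F, R^d), for M a subset of R^d *)
Definition L0in (M : set 'rV[R]_d) : set E :=
  [set x | exists2 f : {mfun T >-> borelrV R d},
             (forall w, M (f w)) & x = ae_class f].

Lemma sigma_stable_L0in (M : set 'rV[R]_d) : sigma_stable (L0in M).
Proof.
move=> A x Mx.
have /choice[f fP] n : exists f : {mfun T >-> borelrV R d},
    (forall w, M (f w)) /\ x n = ae_class f.
  by have [f ? ?] := Mx n; exists f.
exists (glue_mfun A f).
  move=> w /=; have [n _ Anw] : (\bigcup_n A n) w by rewrite mpart_cover.
  by rewrite (glue_funE f Anw); exact: (fP n).1.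
apply/ae_classP.
have : \forall w \ae P, forall n, x n w = f n w.
  apply: ae_foralln => n; rewrite (fP n).2.
  by apply: filterS (ae_classE (f n)) => w; exact.
apply: filterS => w xf _ /=.
have [n _ Anw] : (\bigcup_n A n) w by rewrite mpart_cover.
by rewrite !(glue_funE _ Anw); exact: xf.
Qed.

(* A map between subsets of L^0(F, R^d) is a total map of which only the
   restriction to the domain matters; h : F1 -> E1 and g : E1 -> F1. *)
Definition Tc_r_pair (E1 F1 : set E) (h g : E -> E) : Prop :=
  [/\ set_fun F1 E1 h /\ set_fun E1 F1 g,
      {within F1, continuous h} /\ {within E1, continuous g},
      sigma_stable_map F1 h /\ sigma_stable_map E1 g &
      forall x, E1 x -> h (g x) = x].

Definition Tc_r_image (E1 F1 : set E) : Prop :=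
  exists h g : E -> E, Tc_r_pair E1 F1 h g.

Definition Tc_retract (E1 F1 : set E) : Prop :=
  E1 `<=` F1 /\ exists h : E -> E, Tc_r_pair E1 F1 h id.

End L0rV.

Arguments L0in {d0 T R} P {d} M.

(* Main.v *)
Require Import Defs.
From HB Require Import structures.
From mathcomp Require Import all_boot all_order all_algebra.
From mathcomp Require Import all_classical all_reals all_analysis.
From mathcomp Require Import measurable_realfun ring lra.

(* If h o g = id, then f = g o (-) o h is a stable T_c-continuous self-map of
   L^0(F, ball), and a fixed point x of f satisfies h x = - h x, which is absurd
   on the sphere.  The fixed point comes from a random Brouwer argument: extend f
   to the cube [-1, 1]^d by radial projection and evaluate it at the countably
   many constant grid points.  For each w, Kuhn's lemma yields at every mesh a
   cell on which all coordinates of f - id take both signs; such cells can be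
   selected measurably, and a random subsequence of them converges to a random
   point x.  Stability allows f to be evaluated at random grid points, and
   T_c-continuity then forces f x = x.
   Kuhn's lemma is proved mod 2: the labels are 0-cochains on the grid, and the
   cup product of their coboundaries has integral 1 over the cube by Stokes. *)

Set Implicit Arguments.
Unset Strict Implicit.
Unset Printing Implicit Defensive.

Import Order.TTheory GRing.Theory Num.Theory.
Import numFieldNormedType.Exports.

Local Open Scope ring_scope.

(** * Kuhn's lemma *)

Lemma addF2xx (x : 'F_2) : x + x = 0.
Proof. exact/addrr_pchar2/pchar_Fp. Qed.

(** Every unordered pair of distinct indices is counted once in each order, so it contributes
    [c i j + c i j], which is 0 in ['F_2]. *)
Lemma sum_offdiag_sym (I : finType) (S : {set I}) (c : I -> I -> 'F_2) :
    (forall i j, c i j = c j i) ->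
  \sum_(i in S) \sum_(j in S :\ i) c i j = 0.
Proof.
move=> c_sym.
have split_rank i : \sum_(j in S :\ i) c i j =
    \sum_(j in S | (enum_rank j < enum_rank i)%N) c i j +
    \sum_(j in S | (enum_rank i < enum_rank j)%N) c i j.
  rewrite (bigID (fun j => (enum_rank j < enum_rank i)%N)) /=; congr (_ + _);
    apply: eq_bigl => j; rewrite !inE;
    rewrite -(inj_eq enum_rank_inj) -(inj_eq val_inj) /=; case: ltngtP;
    by rewrite ?andbT ?andbF.
under eq_bigr do rewrite split_rank.
rewrite big_split /= [X in _ + X](exchange_big_dep (mem S)) /=; last first.
  by move=> i j _ /andP[].
rewrite -[X in X + _]/(\sum_(i in S) _).
set A := \sum_(i in S) _; set B := \sum_(j in S) _.
suff -> : B = A by exact: addF2xx.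
by apply: eq_bigr => i iS; apply: eq_big => [j|j _]; [rewrite iS|exact: c_sym].
Qed.

Section Kuhn.
Context (d p : nat).
Implicit Types (S U : {set 'I_d}) (v : {ffun 'I_d -> 'I_p.+1}).

(* Cyclic shift; the wrap-around never occurs in the cells used below. *)
Definition shift U v : {ffun 'I_d -> 'I_p.+1} :=
  [ffun j => if j \in U then ordS (v j) else v j].

Lemma shift_inj U : injective (shift U).
Proof.
move=> v w /ffunP vw; apply/ffunP => j; have := vw j; rewrite !ffunE.
by case: ifP => // _; exact: ordS_inj.
Qed.

Lemma shift1D1 S i v : i \in S -> shift (S :\ i) (shift [set i] v) = shift S v.
Proof.
move=> iS; apply/ffunP => j; rewrite !ffunE !inE.
by have [->|] := eqVneq j i; rewrite ?iS.
Qed.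

(* With the labels seen as mod 2 cochains, [cup l k] is the cubical cup product
   of the coboundaries of [l 0], ..., [l k.-1], evaluated on the cube with
   origin [v] and directions [S]. *)
Fixpoint cup (l : nat -> {ffun 'I_d -> 'I_p.+1} -> 'F_2) k v S : 'F_2 :=
  if k is k'.+1 then
    \sum_(i in S) cup l k' v (S :\ i) *
      (l k' (shift S v) + l k' (shift (S :\ i) v))
  else 1.

Context (l : nat -> {ffun 'I_d -> 'I_p.+1} -> 'F_2).

Let setD1C S i j : S :\ i :\ j = S :\ j :\ i.
Proof. by rewrite !finset.setDDl finset.setUC. Qed.

(** Cocycle condition for a product of coboundaries, by the Leibniz rule: the induction hypothesis
    handles the first [k] factors on each face [S :\ j], and the unmatched terms are symmetric in
    [i] and [j], hence cancel mod 2. *)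
Lemma cup_closed k v S : #|S| = k.+1 ->
  \sum_(i in S) cup l k (shift [set i] v) (S :\ i) =
  \sum_(i in S) cup l k v (S :\ i).
Proof.
elim: k v S => [//|k IHk] v S cardS /=.
have cardD1 j : j \in S -> #|S :\ j| = k.+1.
  by move=> jS; move: cardS; rewrite (cardsD1 j) jS => -[].
transitivity (\sum_(i in S) \sum_(j in S :\ i)
    cup l k (shift [set i] v) (S :\ i :\ j) *
      (l k (shift S v) + l k (shift (S :\ j) v))).
  apply: eq_bigr => i iS; apply: eq_bigr => j; rewrite !inE => /andP[ji jS].
  by rewrite shift1D1// setD1C shift1D1// !inE iS eq_sym ji.
(* Summed over [i] first, the label factor is constant and the inner sum runs over the faces of
   [S :\ j], where the induction hypothesis applies. *)
transitivity (\sum_(j in S) \sum_(i in S :\ j)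
    cup l k (shift [set i] v) (S :\ j :\ i) *
      (l k (shift S v) + l k (shift (S :\ j) v))).
  rewrite (exchange_big_dep (mem S)) /=; last by move=> i j _ /finset.setD1P[].
  apply: eq_bigr => j jS; apply: eq_big => [i|i _]; last by rewrite setD1C.
  by rewrite !inE jS andbT eq_sym andbC.
transitivity (\sum_(j in S) \sum_(i in S :\ j)
    cup l k v (S :\ j :\ i) * (l k (shift S v) + l k (shift (S :\ j) v))).
  by apply: eq_bigr => j jS; rewrite -!mulr_suml IHk ?cardD1.
have distr (F A B : 'I_d -> 'I_d -> 'F_2) :
    \sum_(i in S) \sum_(j in S :\ i) F i j * (A i j + B i j) =
    \sum_(i in S) \sum_(j in S :\ i) F i j * A i j +
    \sum_(i in S) \sum_(j in S :\ i) F i j * B i j.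
  rewrite -big_split; apply: eq_bigr => i _; rewrite -big_split.
  by apply: eq_bigr => j _; rewrite mulrDr.
(* The terms in [shift S v] on the left and in [shift (S :\ i :\ j) v] on the right are symmetric
   and vanish; the remaining two sums coincide. *)
rewrite !distr [X in X + _]sum_offdiag_sym; last by move=> i j; rewrite setD1C.
rewrite add0r [X in _ + X]sum_offdiag_sym ?addr0//.
by move=> i j; rewrite setD1C.
Qed.

(** Label [j] has zero coboundary along every edge of the cube, and each term of the expanded
    product contains such a factor. *)
Lemma cup_eq0 k v S (j : 'I_d) (c : 'F_2) : (j < k)%N ->
    (forall U, U \subset S -> l j (shift U v) = c) ->
  cup l k v S = 0.
Proof.
elim: k S => [//|k IHk] S /= jk lc.
apply: big1 => i iS; move: jk; rewrite ltnS leq_eqVlt => /predU1P[<-|jk].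
  by rewrite !lc ?finset.subsetDl// addF2xx mulr0.
rewrite IHk ?mul0r// => U US; apply: lc.
exact: fintype.subset_trans US (finset.subsetDl _ _).
Qed.

(** Interior layers of the grid cancel in pairs mod 2, leaving the two faces orthogonal to direction
    [i]; invariance of [Q] makes it a condition on the other coordinates only. *)
Lemma sum_telescope (Q : pred {ffun 'I_d -> 'I_p.+1}) i
    (b : {ffun 'I_d -> 'I_p.+1} -> 'F_2) :
    (forall v, Q (shift [set i] v) = Q v) ->
  \sum_(v | Q v && (v i != ord_max)) (b (shift [set i] v) + b v) =
  \sum_(v | Q v && (v i == ord_max)) b v + \sum_(v | Q v && (v i == ord0)) b v.
Proof.
move=> Q_shift.
have -> : \sum_(v | Q v && (v i != ord_max)) (b (shift [set i] v) + b v) =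
    \sum_(v | Q v && (v i != ord0)) b v + \sum_(v | Q v && (v i != ord_max)) b v.
  rewrite big_split /=; congr (_ + _).
  (* Cyclicity makes the shift a bijection, sending the layers other than the top one onto those
     other than the bottom one. *)
  rewrite [RHS](reindex_inj (@shift_inj [set i])).
  apply: eq_bigl => v; rewrite Q_shift ffunE set11; congr (_ && ~~ _).
  rewrite -!(inj_eq val_inj) /=; have [->|vp] := eqVneq (v i : nat) p.
    by rewrite modnn eqxx.
  by rewrite modn_small// ltn_neqAle eqSS vp ltn_ord.
have splitQ c : \sum_(v | Q v) b v =
    \sum_(v | Q v && (v i == c)) b v + \sum_(v | Q v && (v i != c)) b v.
  exact: bigID.
have := etrans (esym (splitQ ord0)) (splitQ ord_max).
set Z := \sum_(v | Q v && (v i == ord0)) b v.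
set M := \sum_(v | Q v && (v i == ord_max)) b v.
set A := \sum_(v | _) b v; set B := \sum_(v | _) b v => AB.
have -> : B = Z + (M + A) by rewrite addrCA AB addrA addF2xx add0r.
by rewrite addrCA (addrCA A) addF2xx addr0 addrC.
Qed.

(** Origins of the unit cells of a [k]-dimensional face of the cube. The other coordinates are
    pinned at the top, where [l_top] makes their labels 1. *)
Definition in_grid k v : bool :=
  [forall j : 'I_d, (v j == ord_max) != (j < k)%N].

Context (l_bot : forall (i : 'I_d) v, v i = ord0 -> l i v = 0).
Context (l_top : forall (i : 'I_d) v, v i = ord_max -> l i v = 1).

(* Stokes: the sum over the k-dimensional grid only sees the faces of the
   boundary, and only the top face in direction [k] contributes. *)
Lemma sum_cup k : (k <= d)%N ->
  \sum_(v | in_grid k v) cup l k v [set j : 'I_d | (j < k)%N] = 1.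
Proof.
elim: k => [_|k IHk kd] /=.
  rewrite (bigD1 [ffun=> ord_max]) /=; last first.
    by apply/forallP => j; rewrite ffunE eqxx.
  rewrite big1 ?addr0// => v /andP[/forallP gv /eqP vN]; case: vN.
  apply/ffunP => j; have := gv j; rewrite ffunE ltn0.
  by rewrite eqbF_neg negbK => /eqP.
set S := [set j : 'I_d | (j < k.+1)%N]; pose K : 'I_d := Ordinal kd.
have cardS : #|S| = k.+1.
  have widen_inj : injective (widen_ord kd).
    by move=> a b /(congr1 val) /= /val_inj.
  rewrite -[RHS](card_ord k.+1) -(card_imset _ widen_inj).
  apply: eq_card => j; rewrite !inE; apply/idP/imsetP => [jk|[j' _ ->]].
    by exists (Ordinal jk) => //; exact: val_inj.
  exact: (ltn_ord j').
have SK : S :\ K = [set j : 'I_d | (j < k)%N].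
  by apply/finset.setP => j; rewrite !inE -(inj_eq val_inj) /= ltnS ltn_neqAle.
pose b i v := cup l k v (S :\ i) * l k (shift (S :\ i) v).
(* Closedness of the product moves the origin in the [shift S v] half by one step in direction [i],
   so a cell contributes the sum of [b] over its opposite faces. *)
transitivity (\sum_(i in S)
    \sum_(v | in_grid k.+1 v) (b i (shift [set i] v) + b i v)).
  rewrite [RHS]exchange_big /=; apply: eq_bigr => v _.
  under eq_bigr do rewrite mulrDr.
  rewrite !big_split /= -mulr_suml -cup_closed// mulr_suml; congr (_ + _).
  by apply: eq_bigr => i iS; rewrite /b shift1D1.
pose Q i v := [forall (j : 'I_d | j != i), (v j == ord_max) != (j < k.+1)%N].
have gridE i v : i \in S -> in_grid k.+1 v = Q i v && (v i != ord_max).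
  rewrite inE => ik; apply/forallP/andP => [gv|[/forall_inP Qv vi] j].
    split; first by apply/forall_inP => j _; exact: gv.
    by have := gv i; rewrite ik eqb_id.
  by have [->|/Qv//] := eqVneq j i; rewrite ik (negbTE vi).
transitivity (\sum_(i in S) (\sum_(v | Q i v && (v i == ord_max)) b i v +
                             \sum_(v | Q i v && (v i == ord0)) b i v)).
  apply: eq_bigr => i iS; rewrite -sum_telescope.
    by apply: eq_bigl => v; exact: gridE.
  move=> v; apply: eq_forallb_in => j ji.
  by rewrite ffunE inE (negbTE ji).
have shiftN i U v : U \subset S :\ i -> shift U v i = v i.
  move=> /fintype.subsetP US; rewrite ffunE; case: ifP => // /US.
  by rewrite !inE eqxx.
rewrite (bigD1 K) /=; last by rewrite inE /=.
(* In a direction [i] below [k], label [i] is constant on both end faces, which kills the product of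
   the first [k] coboundaries. *)
rewrite [X in _ + X]big1 ?addr0; last first.
  move=> i; rewrite inE ltnS => /andP[ik iK].
  have {}ik : (i < k)%N.
    by rewrite ltn_neqAle ik andbT; rewrite -(inj_eq val_inj) in iK.
  rewrite !big1 ?addr0// => v /andP[_ /eqP vi]; rewrite /b.
    by rewrite (@cup_eq0 _ _ _ i 0) ?mul0r// => U /shiftN sU; rewrite l_bot ?sU.
  by rewrite (@cup_eq0 _ _ _ i 1) ?mul0r// => U /shiftN sU; rewrite l_top ?sU.
(* In direction [K] the bottom face carries label 0; the top face carries label 1 and is the
   [k]-dimensional grid. *)
rewrite [X in _ + X]big1 ?addr0; last first.
  by move=> v /andP[_ /eqP vi]; rewrite /b (l_bot (i := K)) ?shiftN// mulr0.
rewrite -(IHk (ltnW kd)); apply: eq_big => [v|v /andP[_ /eqP vi]]; last first.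
  by rewrite /b SK (l_top (i := K)) ?mulr1// -SK shiftN.
apply/andP/forallP => [[/forall_inP Qv vi] j|gv].
  have [->|jK] := eqVneq j K; first by rewrite vi ltnn.
  have := Qv j jK; rewrite -(inj_eq val_inj) /= in jK.
  by rewrite ltnS leq_eqVlt (negbTE jK).
split; last by have := gv K; rewrite ltnn eqbF_neg negbK.
apply/forall_inP => j; rewrite -(inj_eq val_inj) /= => jK.
by rewrite ltnS leq_eqVlt (negbTE jK); exact: gv.
Qed.
End Kuhn.

(** The total over the grid is 1, so some cell has a nonzero product, and by [cup_eq0] no label is
    constant on its vertices. *)
Lemma kuhn d p (l : 'I_d -> {ffun 'I_d -> 'I_p.+1} -> bool) :
    (forall i (v : {ffun 'I_d -> 'I_p.+1}), v i = ord0 -> ~~ l i v) ->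
    (forall i (v : {ffun 'I_d -> 'I_p.+1}), v i = ord_max -> l i v) ->
  exists2 v : {ffun 'I_d -> 'I_p.+1}, (forall i, v i != ord_max) &
    forall i, exists U U', l i (shift U v) && ~~ l i (shift U' v).
Proof.
move=> l_bot l_top.
(* Labels are extended by 0 to all natural numbers, the index type of [cup]. *)
pose m k v : 'F_2 := if insub k is Some i then (l i v)%:R else 0.
have mE (i : 'I_d) v : m i v = (l i v)%:R by rewrite /m valK.
have : \sum_(v | in_grid d v) cup m d v [set j : 'I_d | (j < d)%N] = 1.
  apply: sum_cup => // i v vi; rewrite mE.
    by rewrite (negbTE (l_bot _ _ vi)).
  by rewrite l_top.
have [/existsP[v /andP[/forallP gv cv]] _|] :=
    boolP [exists v, in_grid d v && (cup m d v [set j : 'I_d | (j < d)%N] != 0)].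
  exists v => [i|i]; first by have := gv i; rewrite ltn_ord eqb_id.
  have [/existsP[U lU]|/existsPn nl] := boolP [exists U, l i (shift U v)]; last first.
    case/eqP: cv; apply: (@cup_eq0 _ _ _ _ _ _ i 0) => // U _.
    by rewrite mE (negbTE (nl U)).
  have [/existsP[U' lU']|/existsPn nl] := boolP [exists U, ~~ l i (shift U v)].
    by exists U, U'; rewrite lU.
  case/eqP: cv; apply: (@cup_eq0 _ _ _ _ _ _ i 1) => // V _.
  by rewrite mE (negbNE (nl V)).
rewrite negb_exists => /forallP c0; rewrite big1 => [/esym/eqP|v gv].
  by rewrite oner_eq0.
by have := c0 v; rewrite gv negbK => /eqP.
Qed.

Local Open Scope classical_set_scope.
Local Open Scope ring_scope.

(** * Random indices *)

Section random_index.
Context d0 (T : measurableType d0).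

Definition random_index (I : Type) (N : T -> I) : Prop :=
  forall i, measurable (N @^-1` [set i]).

Lemma measurable_bigcup_count (I : countType) (A : I -> set T) :
  (forall i, measurable (A i)) -> measurable (\bigcup_i A i).
Proof.
move=> mA; pose B n := oapp A set0 (unpickle n).
have -> : \bigcup_i A i = \bigcup_n B n.
  apply/seteqP; split=> [w [i _ Aiw]|w [n _]]; rewrite /B.
    by exists (pickle i) => //; rewrite pickleK.
  by case: unpickle => //= i Aiw; exists i.
by apply: bigcupT_measurable => n; rewrite /B; case: unpickle => [i|] /=.
Qed.

Lemma measurable_forall_count (I : countType) (A : I -> set T) :
  (forall i, measurable (A i)) -> measurable [set w | forall i, A i w].
Proof.
move=> mA; rewrite (_ : [set _ | _] = ~` (\bigcup_i ~` A i)).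
  by apply/measurableC/measurable_bigcup_count => i; exact: measurableC.
rewrite setC_bigcup; apply/seteqP; split=> w Aw i; first by rewrite setCK.
by have := Aw i Logic.I; rewrite setCK.
Qed.

Lemma measurable_lt_set (R : realType) (f g : T -> R) :
    measurable_fun setT f -> measurable_fun setT g ->
  measurable [set w | f w < g w].
Proof.
move=> mf mg; rewrite -[X in measurable X]setTI.
exact: (measurable_fun_ltr mf mg measurableT (Y := [set true])).
Qed.

Lemma measurable_le_set (R : realType) (f g : T -> R) :
    measurable_fun setT f -> measurable_fun setT g ->
  measurable [set w | f w <= g w].
Proof.
move=> mf mg; rewrite -[X in measurable X]setTI.
exact: (measurable_fun_ler mf mg measurableT (Y := [set true])).
Qed.

Lemma measurable_random_index (I : countType) (N : T -> I) (A : I -> set T) :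
    random_index N -> (forall i, measurable (A i)) ->
  measurable [set w | A (N w) w].
Proof.
move=> mN mA.
have -> : [set w | A (N w) w] = \bigcup_i (N @^-1` [set i] `&` A i).
  apply/seteqP; split=> [w ANw|w [i _ [/= <-]]//]; first by exists (N w).
by apply: measurable_bigcup_count => i; exact: measurableI.
Qed.

Lemma random_index_comp (I J : countType) (N : T -> I) (M : I -> T -> J) :
    random_index N -> (forall i, random_index (M i)) ->
  random_index (fun w => M (N w) w).
Proof.
move=> mN mM j.
apply: (measurable_random_index (A := fun i => M i @^-1` [set j])) => // i.
exact: mM.
Qed.

Lemma measurable_Prop (Q : Prop) : measurable [set _ : T | Q].
Proof.
have [q|q] := pselect Q.
  by rewrite (_ : [set _ | _] = setT)//; apply/seteqP; split.
by rewrite (_ : [set _ | _] = set0)//; apply/seteqP; split.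
Qed.

Lemma random_index_cst (I : Type) (i : I) : random_index (fun _ => i).
Proof. by move=> j; exact: measurable_Prop. Qed.

Lemma random_index_map (I J : countType) (N : T -> I) (g : I -> J) :
  random_index N -> random_index (g \o N).
Proof.
move=> mN; apply: (random_index_comp (M := fun i _ => g i)) => // i.
exact: random_index_cst.
Qed.

Lemma measurable_fun_random_index (I : countType) (N : T -> I) d1
    (U : measurableType d1) (u : I -> T -> U) :
    random_index N -> (forall i, measurable_fun setT (u i)) ->
  measurable_fun setT (fun w => u (N w) w).
Proof.
move=> mN mu _ Y mY; rewrite setTI.
apply: (measurable_random_index (A := fun i => u i @^-1` Y)) => // i.
by rewrite -[X in measurable X]setTI; exact: mu.
Qed.

(* The selected index is the first admissible one in the enumeration of [I]. *)
Lemma measurable_selection (I : countType) (Q : I -> set T) :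
    (forall i, measurable (Q i)) -> (forall w, exists i, Q i w) ->
  exists2 N : T -> I, random_index N & forall w, Q (N w) w.
Proof.
(* Numbers that code no element get the empty set; disjointing the [B n] then keeps the least
   admissible code. *)
move=> mQ exQ; pose B n := oapp Q set0 (pickle_inv n).
have mB n : measurable (B n) by rewrite /B; case: pickle_inv => [i|] /=.
have exB w : exists i : I, seqDU B (pickle i) w.
  have : (\bigcup_n B n) w.
    by have [i Qi] := exQ w; exists (pickle i) => //; rewrite /B pickleK_inv.
  rewrite seqDU_bigcup_eq => -[n _ DBn]; have [+ _] := DBn.
  rewrite {1}/B; have := pickle_invK (T := I) n.
  by case: (@pickle_inv I n) => //= i ni _; exists i; rewrite ni.
have [N DN] := choice exB; exists N => [i|w].
  rewrite (_ : N @^-1` [set i] = seqDU B (pickle i)).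
    by apply: measurableD => //; exact: bigsetU_measurable.
  apply/seteqP; split=> [w <-//|w DBi] /=.
  apply: (pcan_inj pickleK); apply: (@trivIset_seqDU _ B) => //.
  by exists w.
by have [+ _] := DN w; rewrite /B pickleK_inv.
Qed.
End random_index.

(** Late suprema of tails are within [e / 2] of the limit superior, and each is approached within
    [e / 2] by a term of its tail. *)
Lemma limn_sup_cluster (R : realType) (u : R^nat) (c : R) :
    (forall n, `|u n| <= c) ->
  forall e n, 0 < e -> exists2 k, (n <= k)%N & `|u k - limn_sup u| < e.
Proof.
move=> uc e n e0.
have ub : has_ubound (range u).
  by exists c => _ [k _ <-]; rewrite (le_trans (ler_norm _)).
have lb : has_lbound (range u).
  by exists (- c) => _ [k _ <-]; rewrite lerNl (le_trans (ler_norm _)) ?normrN.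
have := cvg_sups_inf ub lb; rewrite /limn_sup => /[dup] /cvg_lim -> //.
move=> /cvgrPdist_lt/(_ (e / 2) (divr_gt0 e0 (ltr0n _ 2)))[m _ /(_ (maxn m n))].
rewrite /= leq_maxl => /(_ isT).
set L := inf _; set p := maxn m n => Lp.
have [||_ [k /= pk <-] uk] := @sup_adherent R (sdrop u p) (e / 2).
- exact: divr_gt0.
- split; first by exists (u p), p => /=.
  exact: has_ubound_sdrop.
exists k; first exact: leq_trans (leq_maxr _ _) pk.
have ku : u k <= sups u p.
  by apply: ub_le_sup; [exact: has_ubound_sdrop|exists k].
have {}uk : sups u p - e / 2 < u k by [].
by move: Lp; rewrite !ltr_norml => /andP[? ?]; apply/andP; split; lra.
Qed.

(** * Measurable extraction of convergent subsequences *)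

Section random_subsequence.
Context d0 (T : measurableType d0) (R : realType).

(** The limit superior is a measurable cluster point, so indices beyond [k] at which [u] is within
    [k.+1%:R^-1] of it can be selected measurably. *)
Lemma random_cvg_subseq_real (u : nat -> T -> R) (c : R) :
    (forall n, measurable_fun setT (u n)) -> (forall n w, `|u n w| <= c) ->
  exists l : T -> R, exists N : nat -> T -> nat,
    [/\ measurable_fun setT l, forall k, random_index (N k),
        forall k w, (k <= N k w)%N &
        forall w, u (N k w) w @[k --> \oo] --> l w].
Proof.
move=> mu uc; pose l w := limn_sup (u ^~ w).
have ml : measurable_fun setT l.
  apply: measurable_fun_limn_sup => // w _.
    by exists c => _ [k _ <-]; rewrite (le_trans (ler_norm _)).
  by exists (- c) => _ [k _ <-]; rewrite lerNl (le_trans (ler_norm _)) ?normrN.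
have sel k : exists N : T -> nat,
    random_index N /\ forall w, (k <= N w)%N /\ `|u (N w) w - l w| < k.+1%:R^-1.
  have [||N mN QN] := @measurable_selection _ T nat
      (fun n w => (k <= n)%N /\ `|u n w - l w| < k.+1%:R^-1).
  - move=> n; have [kn|kn] := boolP (k <= n)%N; last first.
      by rewrite (_ : (fun _ => _) = set0)//; apply/seteqP; split=> // w [].
    rewrite (_ : (fun _ => _) = [set w | `|u n w - l w| < k.+1%:R^-1]); last first.
      by apply/seteqP; split=> w => [[]|].
    apply: measurable_lt_set => //.
    apply: measurableT_comp; first exact: normr_measurable.
    exact: measurable_funB.
  - move=> w; have [||n kn un] := @limn_sup_cluster R (u ^~ w) c _ (k.+1%:R^-1) k => //.
    by exists n.
  by exists N.
have [N NP] := choice sel; exists l, N; split=> // [k|k w|w].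
- exact: (NP k).1.
- exact: ((NP k).2 w).1.
apply/cvgrPdist_lt => e e0; near=> k; rewrite distrC.
apply: lt_trans ((NP k).2 w).2 _.
by near: k; exact: near_infty_natSinv_lt (PosNum e0).
Unshelve. all: by end_near. Qed.

(** One coordinate at a time: each step thins the previous subsequence along [M], and [k <= M k w]
    preserves the limits already obtained. *)
Lemma random_cvg_subseq (I : eqType) (s : seq I) (u : I -> nat -> T -> R) (c : R) :
    (forall i n, measurable_fun setT (u i n)) ->
    (forall i n w, `|u i n w| <= c) ->
  exists N : nat -> T -> nat,
    [/\ forall k, random_index (N k), forall k w, (k <= N k w)%N &
        forall i, i \in s -> exists2 l : T -> R, measurable_fun setT l &
          forall w, u i (N k w) w @[k --> \oo] --> l w].
Proof.
move=> mu uc; elim: s => [|i s [N [mN leN cvgN]]].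
  exists (fun k _ => k); split=> // k; exact: random_index_cst.
have [||l [M [ml mM leM cvgM]]] :=
    @random_cvg_subseq_real (fun k w => u i (N k w) w) c.
- by move=> k; exact: (measurable_fun_random_index (u := u i)).
- by move=> *; exact: uc.
exists (fun k w => N (M k w) w); split=> [k|k w|j].
- exact: (random_index_comp (M := N)).
- exact: leq_trans (leM k w) (leN _ _).
rewrite inE => /predU1P[->|/cvgN[l' ml' cvgl']]; first by exists l.
exists l' => // w; apply: (cvg_comp (fun k => M k w) _ _ (cvgl' w)).
by apply/cvgnyPge => k; near=> n; rewrite (leq_trans _ (leM n w))//; near: n;
  exact: nbhs_infty_ge.
Unshelve. all: by end_near. Qed.
End random_subsequence.

(** * Row vectors and the grid *)

Section row_vectors.
Context {R : realType} {d : nat}.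
Implicit Types (v x y : 'rV[R]_d).

Lemma cvg_rV (S : Type) (F : set_system S) (f : S -> 'rV[R]_d) x : Filter F ->
  (forall i, f s ord0 i @[s --> F] --> x ord0 i) -> f s @[s --> F] --> x.
Proof.
move=> FF fx; apply/cvg_ballP => e e0.
have : \forall s \near F, forall i, `|x ord0 i - f s ord0 i| < e.
  by apply: filter_forall => i; have /cvgrPdist_lt := fx i; exact.
apply: filterS => s xf; split=> // i j; rewrite ord1; exact: xf.
Qed.

Lemma continuous_coord i : continuous (fun v => v ord0 i).
Proof. exact: coord_continuous. Qed.

Lemma enorm_ge0 v : 0 <= enorm v. Proof. exact: sqrtr_ge0. Qed.

Lemma sqr_enorm v : enorm v ^+ 2 = \sum_(i < d) v ord0 i ^+ 2.
Proof. by rewrite sqr_sqrtr// sumr_ge0// => i _; rewrite sqr_ge0. Qed.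

Lemma coord_le_enorm v i : `|v ord0 i| <= enorm v.
Proof.
rewrite -(@ler_pXn2r _ 2)// ?nnegrE ?enorm_ge0// sqr_enorm real_normK ?num_real//.
by rewrite (bigD1 i)//= lerDl sumr_ge0// => j _; rewrite sqr_ge0.
Qed.

Lemma enormZ (a : R) v : enorm (a *: v) = `|a| * enorm v.
Proof.
rewrite /enorm -sqrtr_sqr -sqrtrM ?sqr_ge0//; congr Num.sqrt.
by rewrite mulr_sumr; apply: eq_bigr => i _; rewrite mxE exprMn.
Qed.

Lemma enorm_continuous : continuous (@enorm R d).
Proof.
have sqr_cont i : continuous (fun v : 'rV[R]_d => v ord0 i ^+ 2).
  move=> v; apply: (@continuous_comp _ _ _ (fun v => v ord0 i) (fun a : R => a ^+ 2)).
    exact: continuous_coord.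
  exact: exprn_continuous.
move=> x; apply: (@continuous_comp _ _ _
  (fun v : 'rV[R]_d => \sum_(i < d) v ord0 i ^+ 2) Num.sqrt); last exact: sqrt_continuous.
apply: cvg_big => [||i _]; [exact: add_continuous|exact: nbhs_filter|exact: sqr_cont].
Qed.

(** Open sets are countable unions of rational boxes in the sup norm, and box preimages are
    described by finitely many coordinate inequalities. *)
Lemma measurable_rV d0 (T : measurableType d0) (x : T -> 'rV[R]_d) :
    (forall i, measurable_fun setT (fun w => x w ord0 i)) ->
  measurable_fun setT (x : T -> borelrV R d).
Proof.
move=> mx; apply: (@measurability _ _ T (borelrV R d) setT x (@open 'rV[R]_d) erefl).
move=> _ [U oU <-]; rewrite setTI.
pose box (a : {ffun 'I_d -> rat}) (n : nat) :=
  [set v : 'rV[R]_d | forall i, `|v ord0 i - ratr (a i)| < n.+1%:R^-1].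
pose A (an : {ffun 'I_d -> rat} * nat) : set T :=
  [set w | box an.1 an.2 (x w) /\ box an.1 an.2 `<=` U].
have -> : x @^-1` U = \bigcup_an A an.
  apply/seteqP; split=> [w Uxw|w [an _ [+ sub]]]; last exact: sub.
  have /nbhs_ballP[e /= e0 eU] : nbhs (x w) U by exact: open_nbhs_nbhs.
  have e20 : 0 < e / 2 by exact: divr_gt0.
  have [n _ /(_ n (leqnn n)) ne] := near_infty_natSinv_lt (PosNum e20).
  have /choice[a xa] i : exists a : rat, `|x w ord0 i - ratr a| < n.+1%:R^-1.
    have [a] : exists a, ratr a \in `]x w ord0 i - n.+1%:R^-1, x w ord0 i[.
      by apply: rat_in_itvoo; rewrite ltrBlDr ltrDl.
    rewrite in_itv /= => /andP[ax xa]; exists a.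
    by rewrite ger0_norm ?subr_ge0 1?ltW// ltrBlDr addrC -ltrBlDr.
  exists (finfun a, n) => //; split=> [i|v bv].
    by rewrite ffunE.
  apply: eU; split=> // j i; rewrite ord1 [e]splitr.
  apply: (@ball_triangle _ _ (ratr (a i) : R)).
    exact: lt_trans (xa i) ne.
  by apply: ball_sym; apply: lt_trans ne; have := bv i; rewrite ffunE.
apply: measurable_bigcup_count => an; apply: measurableI; last exact: measurable_Prop.
apply: measurable_forall_count => i; apply: measurable_lt_set => //.
by apply: measurableT_comp; [exact: normr_measurable|exact: measurable_funB].
Qed.
End row_vectors.

(** * Radial projection onto the closed ball *)

Section ball_projection.
Context {R : realType} {d : nat}.
Implicit Types (v x y : 'rV[R]_d).

(** The maximum keeps the denominator at least 1, which gives continuity everywhere and the identity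
    on the ball. *)
Definition ball_proj v : 'rV[R]_d := (Num.max 1 (enorm v))^-1 *: v.

Let max_gt0 v : 0 < Num.max 1 (enorm v). Proof. by rewrite lt_max ltr01. Qed.

Lemma ball_projP v : closed_unit_ball (ball_proj v).
Proof.
rewrite /closed_unit_ball /= enormZ gtr0_norm ?invr_gt0//.
by rewrite mulrC ler_pdivrMr// mul1r le_max lexx orbT.
Qed.

Lemma ball_proj_id v : closed_unit_ball v -> ball_proj v = v.
Proof. by move=> v1; rewrite /ball_proj max_l// invr1 scale1r. Qed.

Lemma ball_proj_continuous : continuous ball_proj.
Proof.
move=> x; apply: cvg_rV => [|i]; first exact: nbhs_filter.
under eq_fun do rewrite mxE; rewrite mxE.
have max_cont : {for x, continuous (fun v => Num.max 1 (enorm v) : R^o)}.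
  by apply: continuous_max; [exact: cst_continuous|exact: enorm_continuous].
apply: (@continuousM _ _ (fun v => (Num.max 1 (enorm v))^-1) (fun v => v ord0 i)).
  by apply: continuousV => //; rewrite gt_eqF.
exact: continuous_coord.
Qed.

End ball_projection.

Lemma measurable_continuous_comp (R : realType) d d0 (T : measurableType d0)
    (g : 'rV[R]_d -> 'rV[R]_d) (x : T -> 'rV[R]_d) : continuous g ->
    measurable_fun setT (x : T -> borelrV R d) ->
  measurable_fun setT (g \o x : T -> borelrV R d).
Proof.
move=> /continuousP cg mx.
apply: (@measurability _ _ T (borelrV R d) setT _ (@open 'rV[R]_d) erefl).
move=> _ [U oU <-]; apply: (mx measurableT (g @^-1` U)).
apply: sub_sigma_algebra; exact: cg.
Qed.

(** * Grid nodes and sign-changing cells *)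

Section grid.
Context {R : realType} {d : nat}.

(** Unbounded numerators place the nodes of all meshes in a single countable type, as measurable
    selection requires. *)
Definition grid_index : Type := nat * {ffun 'I_d -> nat}.
HB.instance Definition _ := Countable.on grid_index.

(* The nodes [(n, k)] subdivide the cube [-1, 1]^d into n.+1 slices per axis. *)
Definition grid_point (a : grid_index) : 'rV[R]_d :=
  \row_i ((a.2 i)%:R * 2 / a.1.+1%:R - 1).

(** A base node and, for each coordinate, two witness nodes, meant for a nonpositive and a
    nonnegative displacement respectively. *)
Definition grid_cell : Type :=
  grid_index * ({ffun 'I_d -> grid_index} * {ffun 'I_d -> grid_index}).
HB.instance Definition _ := Countable.on grid_cell.

(* A cell of mesh 2 / n.+1 in which every coordinate of the displacement
   [F - id] takes both signs. *)
Definition sign_cell (F : grid_index -> 'rV[R]_d) n (c : grid_cell) : Prop :=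
  forall i : 'I_d,
  [/\ `|grid_point c.1 ord0 i| <= 1,
      forall j, `|grid_point (c.2.1 i) ord0 j - grid_point c.1 ord0 j| <= 2 / n.+1%:R,
      forall j, `|grid_point (c.2.2 i) ord0 j - grid_point c.1 ord0 j| <= 2 / n.+1%:R,
      F (c.2.1 i) ord0 i <= grid_point (c.2.1 i) ord0 i &
      grid_point (c.2.2 i) ord0 i <= F (c.2.2 i) ord0 i].

(** Kuhn's lemma applied to the labels telling whether [F] lowers a coordinate. *)
Lemma sign_cell_exists (F : grid_index -> 'rV[R]_d) n :
    (forall a i, `|F a ord0 i| <= 1) ->
  exists c, sign_cell F n c.
Proof.
move=> F1; pose idx (v : {ffun 'I_d -> 'I_n.+2}) : grid_index :=
  (n, [ffun j => v j : nat]).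
have ptE v i : grid_point (idx v) ord0 i = (v i)%:R * 2 / n.+1%:R - 1.
  by rewrite !mxE/= ffunE.
have n0 : n.+1%:R != 0 :> R by rewrite pnatr_eq0.
have n_gt0 : 0 < n.+1%:R :> R by rewrite ltr0n.
(* The labels are forced on the two end faces; there the bound on [F] still gives the weak
   inequalities, as the end coordinates are 1 and -1. *)
pose l (i : 'I_d) (v : {ffun 'I_d -> 'I_n.+2}) := (v i == ord_max) ||
  (v i != ord0) && (F (idx v) ord0 i < grid_point (idx v) ord0 i).
have [i v vi|i v vi|v v_max sgn] := @kuhn d n.+1 l.
- by rewrite /l vi.
- by rewrite /l vi eqxx.
have lT i w : l i w -> F (idx w) ord0 i <= grid_point (idx w) ord0 i.
  case/orP => [/eqP wi|/andP[_ /ltW//]].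
  rewrite ptE wi /= (le_trans (ler_norm _))// (le_trans (F1 _ _))//.
  by rewrite mulrAC divff//; lra.
have lF i w : ~~ l i w -> grid_point (idx w) ord0 i <= F (idx w) ord0 i.
  rewrite negb_or negb_and negbK -leNgt => /andP[_ /orP[/eqP wi|//]].
  rewrite ptE wi /= mul0r mul0r sub0r.
  by have := F1 (idx w) i; rewrite ler_norml => /andP[].
have [U lU] := choice sgn.
have [U' lU'] := choice lU.
have near_cell V j :
    `|grid_point (idx (shift V v)) ord0 j - grid_point (idx v) ord0 j| <= 2 / n.+1%:R.
  rewrite !ptE ffunE; case: ifP => _; last first.
    by rewrite subrr normr0 divr_ge0.
  (* Origins of cells avoid the top layer, so the shift does not wrap around. *)
  have vj : (v j < n.+1)%N.
    by rewrite ltn_neqAle -ltnS ltn_ord andbT; exact: v_max.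
  rewrite /= modn_small// -[(v j).+1%:R]natr1.
  rewrite (_ : _ - _ = 2 / n.+1%:R); last by field.
  by rewrite ger0_norm// divr_ge0.
exists (idx v, ([ffun i => idx (shift (U i) v)], [ffun i => idx (shift (U' i) v)])).
move=> i; have /andP[lr ls] := lU' i; rewrite /= !ffunE; split => //.
- rewrite ptE ler_norml lerBrDr addNr divr_ge0 ?mulr_ge0//=.
  rewrite lerBlDr ler_pdivrMr// -[1 + 1]/2%:R mulrC ler_pM2l//.
  by rewrite ler_nat -ltnS.
- by rewrite lT.
- by rewrite lF.
Qed.

End grid.

(** * Maps on L^0 *)

Section L0_maps.
Context d0 (T : measurableType d0) (R : realType) (P : probability T R) (d : nat).
Local Notation E := (L0rV P d).
Implicit Types (x y z : E) (S : set E) (f g : E -> E).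

Lemma ae_class_ae (u : {mfun T >-> borelrV R d}) :
  \forall w \ae P, (ae_class P u : E) w = u w.
Proof. by apply: filterS (ae_classE P u) => w; exact. Qed.

Lemma L0rV_eqP x y : (\forall w \ae P, x w = y w) -> x = y.
Proof.
move=> xy; rewrite -[x]reprK -[y]reprK; apply/ae_classP.
by apply: filterS xy => w xy _; exact: xy.
Qed.

Lemma L0in_ae (M : set 'rV[R]_d) x : L0in P M x -> \forall w \ae P, M (x w).
Proof. by move=> [u Mu ->]; apply: filterS (ae_class_ae u) => w ->. Qed.

Lemma glue_ae (A : mpartition T) (x : nat -> E) :
  \forall w \ae P, forall n, A n w -> Defs.glue A x w = x n w.
Proof.
move: (ae_class_ae (glue_mfun A (fun n => repr (x n)))).
by apply: filterS => w gw n Anw; rewrite gw /= (glue_funE _ Anw).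
Qed.

(** The epsilon-delta form of continuity within [S], with random radii. *)
Definition Tc_continuous_on S f : Prop :=
  forall x (r : L0 P), S x -> L0pp r -> exists2 s : L0 P, L0pp s &
    forall y, S y -> rball x s y -> rball (f x) r (f y).

(** By the triangle inequality, a basic ball around another centre [z] contains the ball around [x]
    whose radius is the slack [s w - enorm (z w - x w)]. *)
Lemma nbhs_rball x (U : set E) : nbhs x U ->
  exists2 r : L0 P, L0pp r & rball x r `<=` U.
Proof.
rewrite nbhsE => -[V [/open_rballsP[B Brb <-] [C BC Cx]] VU].
have [z [s [s0 CE]]] := Brb _ BC; rewrite {}CE in BC Cx.
have mf : measurable_fun setT (fun w => s w - enorm (z w - x w) : measurableTypeR R).
  apply: measurable_funB; first exact: (@measurable_funPT _ _ _ _ (repr s)).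
  exact: measurable_enormB.
have [r rE] := L0_of_fun P mf; exists r.
  by move: Cx rE; apply: filterS2 => w zx ->//; rewrite subr_gt0.
move=> y xy; apply: VU; exists (rball z s) => //.
move: xy rE; apply: filterS2 => w /[swap] -> //.
rewrite ltrBrDl; apply: le_lt_trans.
by rewrite -[X in enorm X](subrKA (x w)) enormD.
Qed.

Lemma rball_nbhs x (r : L0 P) : L0pp r -> nbhs x (rball x r).
Proof.
move=> r0; apply: open_nbhs_nbhs; split.
  apply/open_rballsP; exists [set rball x r]; last by rewrite bigcup_set1.
  by move=> _ ->; exists x, r.
by apply: filterS r0 => w; rewrite subrr enorm0.
Qed.

Lemma within_continuous_Tc S f :
  {within S, continuous f} -> Tc_continuous_on S f.
Proof.
move=> /subspace_continuousP cf x r Sx r0.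
have := cf x Sx _ (rball_nbhs (f x) r0).
rewrite /fmap /= => /nbhs_rball[s s0 sS]; exists s => // y Sy xy.
exact: sS.
Qed.

Lemma Tc_continuous_on_comp S S' f g : (forall x, S x -> S' (f x)) ->
  Tc_continuous_on S f -> Tc_continuous_on S' g -> Tc_continuous_on S (g \o f).
Proof.
move=> SS' cf cg x r Sx r0.
have [s s0 gs] := cg _ _ (SS' _ Sx) r0.
have [t t0 ft] := cf _ _ Sx s0.
by exists t => // y Sy /(ft _ Sy); exact/gs/SS'.
Qed.

Lemma measurable_L0N x : measurable_fun setT (fun w => - x w : borelrV R d).
Proof.
apply: (measurable_continuous_comp (g := -%R)); first exact: opp_continuous.
exact: (@measurable_funPT _ _ _ _ (repr x)).
Qed.

Definition L0N x : E := ae_class P (mfun_Sub (mem_set (measurable_L0N x))).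

Lemma L0N_ae x : \forall w \ae P, L0N x w = - x w.
Proof. exact: ae_class_ae. Qed.

Lemma L0N_sphere x :
  L0in P (@unit_sphere R d) x -> L0in P (@unit_sphere R d) (L0N x).
Proof.
move=> [u u1 xu].
have mu : measurable_fun setT (fun w => - u w : borelrV R d).
  apply: (measurable_continuous_comp (g := -%R)); first exact: opp_continuous.
  exact: measurable_funPT.
exists (mfun_Sub (mem_set mu)) => [w|].
  by rewrite /unit_sphere /= enormN; exact: u1.
apply/ae_classP; rewrite xu.
by apply: filterS (ae_class_ae u) => w + _ /= => ->.
Qed.

Lemma L0N_stable S : sigma_stable_map S L0N.
Proof.
move=> A x _; apply: L0rV_eqP.
have nx : \forall w \ae P, forall n, L0N (x n) w = - x n w.
  by apply: ae_foralln => n; exact: L0N_ae.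
have gN : \forall w \ae P, Defs.glue A (L0N \o x) w = - Defs.glue A x w.
  move: nx (glue_ae A (L0N \o x)) (glue_ae A x).
  apply: filterS3 => w nx g1 g2.
  have [n _ Anw] : (\bigcup_n A n) w by rewrite mpart_cover.
  by rewrite (g1 _ Anw) (g2 _ Anw) /= nx.
by move: gN (L0N_ae (Defs.glue A x)); apply: filterS2 => w -> ->.
Qed.

Lemma Tc_continuous_L0N S : Tc_continuous_on S L0N.
Proof.
move=> x r _ r0; exists r => // y _.
move: (L0N_ae x) (L0N_ae y); apply: filterS3 => w -> ->.
by rewrite -opprD enormN.
Qed.

(* Stability turns evaluation at a random index into a gluing along the level
   sets of that index. *)
Lemma stable_random_index S f (I : countType) (N : T -> I)
    (y F : I -> {mfun T >-> borelrV R d}) (z : E) :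
    sigma_stable_map S f -> random_index N ->
    (forall i, S (ae_class P (y i))) ->
    (forall i, f (ae_class P (y i)) = ae_class P (F i)) ->
    (\forall w \ae P, z w = y (N w) w) ->
  \forall w \ae P, f z w = F (N w) w.
Proof.
move=> stf mN Sy fy zy.
pose B n := [set w | pickle (N w) = n].
have mB n : measurable (B n) by exact: (random_index_map pickle mN).
have tB : trivIset setT B by move=> m n _ _ [w []] /= <- <-.
have cB : \bigcup_n B n = setT.
  by apply/seteqP; split=> // w _; exists (pickle (N w)).
pose A := MPartition mB tB cB.
(* Codes outside the range of [pickle] take a default index; their level sets are empty. *)
pose u n := odflt (N point) (unpickle n).
have yA : z = Defs.glue A (fun n => ae_class P (y (u n))).
  apply: L0rV_eqP.
  have yc : \forall w \ae P, forall n, (ae_class P (y (u n)) : E) w = y (u n) w.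
    by apply: ae_foralln => n; exact: ae_class_ae.
  move: zy yc (glue_ae A (fun n => ae_class P (y (u n)))).
  apply: filterS3 => w -> yc gw.
  by rewrite (gw (pickle (N w)) erefl) yc /u pickleK.
have Fc : \forall w \ae P, forall n, (ae_class P (F (u n)) : E) w = F (u n) w.
  by apply: ae_foralln => n; exact: ae_class_ae.
rewrite yA stf//.
move: Fc (glue_ae A (f \o (fun n => ae_class P (y (u n))))).
apply: filterS2 => w Fc gw.
by rewrite (gw (pickle (N w)) erefl) /= fy Fc /u pickleK.
Qed.

End L0_maps.

(** * The random Brouwer theorem *)

Section random_brouwer.
Context d0 (T : measurableType d0) (R : realType) (P : probability T R) (d : nat).
Local Notation E := (L0rV P d).
Local Notation B := (L0in P (@closed_unit_ball R d)).
Local Notation grid_index := (@grid_index d).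
Local Notation grid_cell := (@grid_cell d).
Local Notation grid_point := (@grid_point R d).

Lemma measurable_coord_mfun (u : {mfun T >-> borelrV R d}) i :
  measurable_fun setT (fun w => (u w : 'rV[R]_d) ord0 i).
Proof. exact: (measurableT_comp (measurable_coord i) (measurable_funPT u)). Qed.

(** Measurably selected cells at every mesh have bounded base nodes, so a random subsequence of
    these converges; the witness nodes stay within the mesh and share the limit. *)
Lemma random_sign_cells (F : grid_index -> {mfun T >-> borelrV R d}) :
    (forall a w i, `|(F a w : 'rV[R]_d) ord0 i| <= 1) ->
  exists (x : T -> 'rV[R]_d) (c : nat -> T -> grid_cell),
    [/\ measurable_fun setT (x : T -> borelrV R d),
        forall k, random_index (c k),
        forall k w, exists n, sign_cell (fun a => F a w) n (c k w),
        forall w i, grid_point ((c k w).2.1 i) @[k --> \oo] --> x w &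
        forall w i, grid_point ((c k w).2.2 i) @[k --> \oo] --> x w].
Proof.
move=> F1.
have mcell n c : measurable [set w | sign_cell (fun a => F a w) n c].
  pose A (i : 'I_d) := [set _ : T |
    [/\ `|grid_point c.1 ord0 i| <= 1,
      forall j, `|grid_point (c.2.1 i) ord0 j - grid_point c.1 ord0 j| <= 2 / n.+1%:R &
      forall j, `|grid_point (c.2.2 i) ord0 j - grid_point c.1 ord0 j| <= 2 / n.+1%:R]].
  rewrite (_ : [set _ | _] = [set w | forall i, (A i `&`
      ([set w | (F (c.2.1 i) w : 'rV[R]_d) ord0 i <= grid_point (c.2.1 i) ord0 i] `&`
       [set w | grid_point (c.2.2 i) ord0 i <= (F (c.2.2 i) w : 'rV[R]_d) ord0 i])) w]).
    apply: measurable_forall_count => i; apply: measurableI; first exact: measurable_Prop.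
    by apply: measurableI; apply: measurable_le_set => //; exact: measurable_coord_mfun.
  by apply/seteqP; split=> w cw i; have := cw i; [case=> ? ? ? ? ?|case=> -[? ? ?] [? ?]].
have /choice[C CP] n : exists C : T -> grid_cell,
    random_index C /\ forall w, sign_cell (fun a => F a w) n (C w).
  have ex w : exists c, sign_cell (fun a => F a w) n c.
    by apply: sign_cell_exists => a i; exact: F1.
  by have [C mC CP] := measurable_selection (mcell n) ex; exists C.
pose u j n w : R := grid_point (C n w).1 ord0 j.
have [||N [mN leN cvgN]] := @random_cvg_subseq _ T R _ (enum 'I_d) u 1.
- move=> j n; apply: (measurable_fun_random_index (u := fun c _ => grid_point c.1 ord0 j)).
    exact: (CP n).1.
  by move=> c; exact: measurable_cst.
- by move=> j n w; have [] := (CP n).2 w j.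
have /choice[l lP] j : exists l : T -> R, measurable_fun setT l /\
    forall w, u j (N k w) w @[k --> \oo] --> l w.
  have j_enum : j \in enum 'I_d by rewrite mem_enum.
  by have [l ml cl] := cvgN j j_enum; exists l.
pose c k w := C (N k w) w.
have cP k w : sign_cell (fun a => F a w) (N k w) (c k w) by exact: (CP _).2.
have node_cvg w (a : nat -> grid_index) :
    (forall k j, `|grid_point (a k) ord0 j - grid_point (c k w).1 ord0 j|
      <= 2 / (N k w).+1%:R) ->
  grid_point (a k) @[k --> \oo] --> (\row_j l j w : 'rV[R]_d).
  have double_half (a1 a2 e : R) : a1 <= a2 -> a2 < e / 4 -> 2 * a1 <= e / 2 by lra.
  move=> aq; apply: cvg_rV => j; rewrite mxE.
  apply/cvgrPdist_lt => e e0; near=> k.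
  have uk : `|l j w - u j (N k w) w| < e / 2.
    near: k; have /cvgrPdist_lt := (lP j).2 w; apply; exact: divr_gt0.
  have ek : k.+1%:R^-1 < e / 4.
    near: k; have e4 : 0 < e / 4 by exact: divr_gt0.
    exact: (near_infty_natSinv_lt (PosNum e4)).
  have Nk : (N k w).+1%:R^-1 <= k.+1%:R^-1 :> R.
    by rewrite lef_pV2 ?posrE ?ltr0n// ler_nat ltnS.
  have := aq k j; rewrite distrC; move: uk; rewrite /u -/(c k w) => uk ak.
  rewrite -(subrKA (grid_point (c k w).1 ord0 j)).
  rewrite [e]splitr; apply: le_lt_trans (ler_normD _ _) _.
  by apply: (ltr_leD uk); apply: le_trans ak _; exact: double_half Nk ek.
exists (fun w => \row_j l j w), c; split=> [||k w|w i|w i].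
- apply: measurable_rV => i; under eq_fun do rewrite mxE; exact: (lP i).1.
- by move=> k; apply: (random_index_comp (M := C)) => // n; exact: (CP n).1.
- by exists (N k w); exact: cP.
- by apply: (node_cvg w (fun k => (c k w).2.1 i)) => k; have [] := cP k w i.
- by apply: (node_cvg w (fun k => (c k w).2.2 i)) => k; have [] := cP k w i.
Unshelve. all: by end_near. Qed.

Lemma random_brouwer (f : E -> E) :
    (forall x, B x -> B (f x)) -> Tc_continuous_on B f -> sigma_stable_map B f ->
  exists2 x, B x & f x = x.
Proof.
move=> fB cf stf.
have mcst (v : 'rV[R]_d) : measurable_fun setT (fun _ : T => v : borelrV R d).
  exact: measurable_cst.
pose y a : {mfun T >-> borelrV R d} :=
  mfun_Sub (mem_set (mcst (ball_proj (grid_point a)))).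
have By a : B (ae_class P (y a)).
  by exists (y a) => // w; exact: ball_projP.
(* Representatives with values in the ball for every [w], so that the sign-cell argument runs
   without exceptional sets. *)
have /choice[F FP] a : exists u : {mfun T >-> borelrV R d},
    (forall w, closed_unit_ball (u w : 'rV[R]_d)) /\ f (ae_class P (y a)) = ae_class P u.
  by have [u u1 fu] := fB _ (By a); exists u.
have F1 a w i : `|(F a w : 'rV[R]_d) ord0 i| <= 1.
  exact: le_trans (coord_le_enorm _ _) ((FP a).1 w).
have [x [c [mx mc cP cvg1 cvg2]]] := random_sign_cells F1.
have mpx : measurable_fun setT (fun w => ball_proj (x w) : borelrV R d).
  exact: (measurable_continuous_comp ball_proj_continuous mx).
(* The limit [x] need not lie in the ball a priori, so [f] is evaluated at its projection. *)
pose px : {mfun T >-> borelrV R d} := mfun_Sub (mem_set mpx).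
pose X : E := ae_class P px.
have BX : B X by exists px => // w; exact: ball_projP.
have Xx : \forall w \ae P, X w = ball_proj (x w) by exact: ae_class_ae.
pose node (bi : bool * 'I_d) (c0 : grid_cell) : grid_index :=
  if bi.1 then c0.2.1 bi.2 else c0.2.2 bi.2.
have node_cvg bi w : grid_point (node bi (c k w)) @[k --> \oo] --> x w.
  by case: bi => -[] i; [exact: cvg1|exact: cvg2].
have mxi i : measurable_fun setT (fun w => x w ord0 i).
  exact: (measurableT_comp (measurable_coord i) mx).
(* At the two witness nodes coordinate [i] of [F] lies on either side of the node's own, which is
   within [e] of [x], while [F] is within [e] of [f X]. *)
have close (e : R) : 0 < e ->
    \forall w \ae P, forall i, `|(f X w : 'rV[R]_d) ord0 i - x w ord0 i| <= e + e.
  move=> e0.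
  have [r rE] := L0_of_fun P (measurable_cst (e : measurableTypeR R)).
  have r0 : L0pp r by apply: filterS rE => w -> //.
  have [s s0 fs] := cf X r BX r0.
  have ms : measurable_fun setT (s : T -> measurableTypeR R).
    exact: (@measurable_funPT _ _ _ _ (repr s)).
  pose A bi (c0 : grid_cell) := [set w |
     enorm (ball_proj (x w) - ball_proj (grid_point (node bi c0))) < s w /\
     `|grid_point (node bi c0) ord0 bi.2 - x w ord0 bi.2| < e].
  have mA bi c0 : measurable (A bi c0).
    apply: measurableI; apply: measurable_lt_set => //.
      exact: (measurable_enormB px (y (node bi c0))).
    by apply: measurableT_comp; [exact: normr_measurable|exact: measurable_funB].
  (* The alternative [s w <= 0] makes the selection total; it fails almost surely. *)
  have [||M mM MP] := @measurable_selection _ T nat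
      (fun k w => s w <= 0 \/ forall bi, A bi (c k w) w).
  - move=> k; apply: measurableU; first exact: measurable_le_set.
    apply: measurable_forall_count => bi.
    exact: (measurable_random_index (A := A bi)).
  - move=> w; have [sw0|sw0] := leP (s w) 0; first by exists 0%N; left.
    suff : \forall k \near \oo, forall bi, A bi (c k w) w.
      by move=> [k _ /(_ k (leqnn k)) Ak]; exists k; right.
    apply: filter_forall => bi; apply: filterI.
      have dist_cont : continuous (fun v => enorm (ball_proj (x w) - ball_proj v)).
        move=> v; apply: (@continuous_comp _ _ _
            (fun v => ball_proj (x w) - ball_proj v) (@enorm R d)).
          by apply: continuousB; [exact: cst_continuous|exact: ball_proj_continuous].
        exact: enorm_continuous.
      have := cvg_comp (fun k => grid_point (node bi (c k w)))
        (fun v => enorm (ball_proj (x w) - ball_proj v)) (node_cvg bi w) (dist_cont (x w)).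
      rewrite subrr enorm0 => /cvgrPdist_lt/(_ _ sw0).
      apply: filterS => k; rewrite sub0r normrN ger0_norm//.
      exact: enorm_ge0.
    have /cvgrPdist_lt/(_ _ e0) :
        grid_point (node bi (c k w)) ord0 bi.2 @[k --> \oo] --> x w ord0 bi.2.
      exact: cvg_comp (node_cvg bi w) (@continuous_coord _ _ bi.2 (x w)).
    by apply: filterS => k; rewrite distrC.
  pose K bi w := node bi (c (M w) w).
  have mK bi : random_index (K bi).
    have mcM : random_index (fun w => c (M w) w) by exact: (random_index_comp (M := c)).
    exact: (random_index_map (node bi) mcM).
  have mz bi : measurable_fun setT (fun w => ball_proj (grid_point (K bi w)) : borelrV R d).
    exact: (measurable_fun_random_index
      (u := fun a _ => ball_proj (grid_point a) : borelrV R d)).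
  pose z bi : E := ae_class P (mfun_Sub (mem_set (mz bi))).
  have zE bi : \forall w \ae P, z bi w = ball_proj (grid_point (K bi w)).
    exact: ae_class_ae.
  have Bz bi : B (z bi).
    by exists (mfun_Sub (mem_set (mz bi))) => // w; exact: ball_projP.
  (* By stability, [f] at the random node agrees with the values [F] taken at the constant nodes. *)
  have fz bi : \forall w \ae P, f (z bi) w = F (K bi w) w.
    apply: (stable_random_index stf (mK bi) By) => // a.
    exact: (FP a).2.
  have AK : \forall w \ae P, forall bi, A bi (c (M w) w) w.
    by apply: filterS s0 => w sw; case: (MP w) => //; rewrite leNgt sw.
  have zX bi : rball X s (z bi).
    by move: Xx (zE bi) AK; apply: filterS3 => w -> -> /(_ bi)[].
  have fzX bi : \forall w \ae P, enorm (f X w - F (K bi w) w) < e.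
    move: (fs _ (Bz bi) (zX bi)) (fz bi) rE.
    by apply: filterS3 => w + fzw rw; rewrite -fzw -[e]/(cst e w) -rw.
  have {}fzX : \forall w \ae P, forall bi, enorm (f X w - F (K bi w) w) < e.
    by apply: filter_forall => bi; exact: fzX.
  move: fzX AK; apply: filterS2 => w fw Aw i.
  have [n sc] := cP (M w) w; have [_ _ _ Fr Fs] := sc i.
  have dist bi : `|(f X w : 'rV[R]_d) ord0 i - (F (K bi w) w : 'rV[R]_d) ord0 i| < e.
    apply: le_lt_trans (fw bi).
    have := coord_le_enorm (f X w - F (K bi w) w) i.
    by rewrite !mxE.
  have [_ xr] := Aw (true, i); have [_ xs] := Aw (false, i).
  have := dist (true, i); have := dist (false, i).
  move: xr xs Fr Fs; rewrite /K /node /= !ltr_norml ler_norml.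
  move=> /andP[? ?] /andP[? ?] ? ? /andP[? ?] /andP[? ?].
  by apply/andP; split; lra.
(* Letting [e] run through the numbers [n.+1%:R^-1] keeps the exceptional sets countable in
   number. *)
have fXx : \forall w \ae P, f X w = x w.
  have : \forall w \ae P, forall n i,
      `|(f X w : 'rV[R]_d) ord0 i - x w ord0 i| <= n.+1%:R^-1 + n.+1%:R^-1.
    by apply: ae_foralln => n; apply: close; rewrite invr_gt0.
  apply: filterS => w fx; apply/rowP => i; apply/eqP; rewrite -subr_eq0 -normr_le0.
  apply/ler_addgt0Pr => e e0; rewrite add0r.
  have e2 : 0 < e / 2 by exact: divr_gt0.
  have [n _ /(_ n (leqnn n)) ne] := near_infty_natSinv_lt (PosNum e2).
  by rewrite [e]splitr (le_trans (fx n i))// lerD// ltW.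
(* Values of [f X] lie in the ball, so almost surely [x] does too and equals its projection. *)
exists X => //; apply: L0rV_eqP.
move: fXx Xx (L0in_ae (fB X BX)); apply: filterS3 => w -> -> xw.
by rewrite ball_proj_id.
Qed.

Lemma sphere_not_r_image :
  ~ Tc_r_image (L0in P (@unit_sphere R d)) B.
Proof.
move=> [h [g [[hB gS] [ch cg] [sth stg] hgK]]].
pose S := L0in P (@unit_sphere R d).
have hS x : B x -> S (h x) by move=> Bx; exact: hB.
have gB x : S x -> B (g x) by move=> Sx; exact: gS.
have [x Bx fx] : exists2 x, B x & g (L0N (h x)) = x.
  apply: (random_brouwer (f := fun x => g (L0N (h x)))) => [x Bx||].
  - exact/gB/L0N_sphere/hS.
  - apply: (@Tc_continuous_on_comp _ _ _ _ _ B S (fun x => L0N (h x)) g).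
    + by move=> x Bx; exact/L0N_sphere/hS.
    + apply: (@Tc_continuous_on_comp _ _ _ _ _ B S h (@L0N _ _ _ _ _)) => //.
        exact: within_continuous_Tc.
      exact: Tc_continuous_L0N.
    + exact: within_continuous_Tc.
  - move=> A x Bx; rewrite sth//.
    rewrite (@L0N_stable _ _ _ _ _ S) => [|n]; last exact/hS/Bx.
    by rewrite stg// => n; exact/L0N_sphere/hS/Bx.
have hx : h x = L0N (h x) by rewrite -[in LHS]fx hgK//; exact/L0N_sphere/hS.
(* [h x] is its own negative, hence 0 almost surely, which the norm 1 forbids; the whole space would
   then be a null set. *)
suff [N [mN N0 NT]] : \forall w \ae P, False.
  have : (P setT <= 0)%E by rewrite -N0 le_measure ?inE// => w _; apply: NT.
  by rewrite probability_setT lee_fin ler10.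
move: (L0in_ae (hS x Bx)) (L0N_ae (h x)); rewrite -hx.
apply: filterS2 => w hw hN; have h0 : h x w = 0.
  apply/eqP; have := @eqxx _ (h x w); rewrite {2}hN -subr_eq0 opprK.
  by rewrite -mulr2n -scaler_nat scaler_eq0 pnatr_eq0.
by move: hw; rewrite h0 /unit_sphere /= enorm0 => /esym/eqP; rewrite oner_eq0.
Qed.
End random_brouwer.

Theorem theorem6p4 (R : realType) (disp : measure_display)
    (Omega : measurableType disp) (P : probability Omega R)
    (d : nat) (d_gt0 : (0 < d)%N) :
  ~ Tc_r_image (L0in P (@unit_sphere R d)) (L0in P (@closed_unit_ball R d)) /\
  ~ Tc_retract (L0in P (@unit_sphere R d)) (L0in P (@closed_unit_ball R d)).
Proof.
split; first exact: sphere_not_r_image.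
by move=> [_ [h hP]]; apply: (@sphere_not_r_image _ _ _ P d); exists h, id.
Qed.
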